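(* Let $G$ be a finite non-cyclic group. Then there exist a subgroup $H \leq G$ and elements $x, y, z, a \in G$ such that the five subgroups $H, \langle x\rangle, \langle y\rangle, \langle z\rangle, \langle a\rangle$ form a diamond in the subgroup lattice of $G$ with top $H$, middle elements $\langle x\rangle, \langle y\rangle, \langle z\rangle$ and bottom $\langle a\rangle$, and such that $\langle a\rangle$ is a maximal subgroup of both $\langle x\rangle$ and $\langle y\rangle$.
   Context: $\langle x_1,\ldots,x_n\rangle$ denotes the subgroup generated by $x_1,\ldots,x_n$. In the lattice of subgroups of a group, the meet $A\wedge B$ is $A\cap B$ and the join $A\vee B$ is the subgroup generated by $A\cup B$. A diamond (a sublattice isomorphic to $M_3$) with top $T$, middle elements $A,B,C$ and bottom $D$ consists of five pairwise distinct subgroups such that $A\vee B=A\vee C=B\vee C=T$ and $A\wedge B=A\wedge C=B\wedge C=D$. The top $H$ is not required to be cyclic. *)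

(* Defs.v *)
From mathcomp Require Import all_boot all_fingroup all_solvable.

Set Implicit Arguments.
Unset Strict Implicit.
Unset Printing Implicit Defensive.

Import GroupScope.

Definition diamond (gT : finGroupType) (T A B C D : {group gT}) : Prop :=
  [/\ uniq [:: T; A; B; C; D],
      [/\ A <*> B :=: T, A <*> C :=: T & B <*> C :=: T]
    & [/\ A :&: B :=: D, A :&: C :=: D & B :&: C :=: D]].

(* Main.v *)
Require Import Defs.
From mathcomp Require Import all_boot all_fingroup all_solvable.

(** Pass to a minimal non-cyclic subgroup H of G, so that every proper
    subgroup of H is cyclic. The point is that any two distinct maximal
    subgroups of H then meet in one and the same subgroup Z
    ([maximal_meet_const]): the centre of H if H is not abelian, and the
    trivial group if H is abelian, in which case H has order p ^ 2 and exponent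
    p. Modulo Z, the group H is thus partitioned by its maximal subgroups.

    Since H is not a union of two proper subgroups, it has three distinct
    maximal subgroups ([three_maximals]), and each contains Z properly. In
    each of them choose a subgroup X minimal among those properly containing
    Z, so that Z is maximal in X. An X lies in no maximal subgroup but the
    chosen one, so any two of the three generate H, and they meet in Z
    ([join_meet_over_const]). They are proper in H, hence cyclic. *)

Set Implicit Arguments.
Unset Strict Implicit.
Unset Printing Implicit Defensive.

Import GroupScope.

Lemma maximal_join_full (gT : finGroupType) (G M K : {group gT}) :
  maximal M G -> K \subset G -> ~~ (K \subset M) -> M <*> K = G.
Proof.
case/maxgroupP=> prM maxM sKG nsKM; apply/eqP; rewrite eqEproper.
rewrite join_subG (proper_sub prM) sKG /=.
apply/negP=> prMK; case/negP: nsKM.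
by rewrite -(maxM (M <*> K)%G prMK (joing_subl M K)) joing_subr.
Qed.

Lemma maximal_subset_eq (gT : finGroupType) (G M N : {group gT}) :
  maximal M G -> maximal N G -> N \subset M -> N = M.
Proof.
move=> /maxgroupP[prM _] /maxgroupP[_ maxN] sNM.
by apply/val_inj; rewrite /= (maxN M).
Qed.

(** Both maximal subgroups centralise their meet because they are abelian, so
    the meet is central. Conversely a maximal subgroup M that misses part of
    the centre would give G = M Z(G), which is abelian. *)
Lemma maximal_meet_center (gT : finGroupType) (G M N : {group gT}) :
    ~~ abelian G -> abelian M -> abelian N ->
    maximal M G -> maximal N G -> M != N ->
  M :&: N = 'Z(G).
Proof.
move=> nabG abM abN maxM maxN neqMN.
have sMG := proper_sub (maxgroupp maxM).
have sNG := proper_sub (maxgroupp maxN).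
have sZ (K : {group gT}) : abelian K -> maximal K G -> 'Z(G) \subset K.
  move=> abK maxK; apply/negPn/negP=> nsZK; case/negP: nabG.
  rewrite -(maximal_join_full maxK (center_sub G) nsZK) abelianY abK.
  rewrite center_abelian /= (subset_trans (subsetIr _ _)) // centS //.
  exact: proper_sub (maxgroupp maxK).
apply/eqP; rewrite eqEsubset subsetI !sZ // andbT subsetI.
rewrite (subset_trans (subsetIl _ _) sMG) /=.
have nsNM: ~~ (N \subset M).
  by apply: contra neqMN => /(maximal_subset_eq maxM maxN)->.
rewrite -(maximal_join_full maxM sNG nsNM) centsC join_subG.
by rewrite (sub_abelian_cent abM) ?subsetIl // (sub_abelian_cent abN) ?subsetIr.
Qed.

Lemma maximal_meet_p2group (gT : finGroupType) (p : nat) (G M N : {group gT}) :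
    p.-group G -> logn p #|G| = 2 ->
    maximal M G -> maximal N G -> M != N ->
  M :&: N = 1.
Proof.
move=> pG logG maxM maxN neqMN.
have prM := maxgroupp maxM.
have pM := pgroupS (proper_sub prM) pG.
have prI: M :&: N \proper M.
  rewrite properE subsetIl subsetI subxx /=.
  by apply: contra neqMN => /(maximal_subset_eq maxN maxM)->.
have ltM := properG_ltn_log pG prM.
have ltI := properG_ltn_log pM prI.
apply/eqP; rewrite trivg_card1 (card_pgroup (pgroupS (subsetIl M N) pM)) /=.
have /eqP->: logn p #|M :&: N| == 0; last by [].
by rewrite logG in ltM; rewrite -leqn0 -ltnS (leq_trans ltI).
Qed.

(** A non-cyclic abelian group contains an elementary abelian group of rank 2,
    which by minimality is the whole group. *)
Lemma maximal_meet_const (gT : finGroupType) (G : {group gT}) :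
    ~~ cyclic G -> (forall K : {group gT}, K \proper G -> cyclic K) ->
  exists Z : {group gT}, forall M N : {group gT},
    maximal M G -> maximal N G -> M != N -> M :&: N = Z.
Proof.
move=> ncG cycG; have [abG | nabG] := boolP (abelian G); last first.
  exists 'Z(G)%G => M N maxM maxN; apply: maximal_meet_center => //.
    exact: cyclic_abelian (cycG _ (maxgroupp maxM)).
  exact: cyclic_abelian (cycG _ (maxgroupp maxN)).
have [p p_pr rG] := rank_witness G.
have /p_rank_geP[E /pnElemP[sEG abelE logE]]: 1 < 'r_p(G).
  by rewrite -rG ltnNge -abelian_rank1_cyclic.
have defG: E :=: G.
  apply/eqP; rewrite eqEproper sEG /=; apply/negP=> /cycG.
  by rewrite (abelem_cyclic abelE) logE.
exists 1%G => M N; apply: (@maximal_meet_p2group _ p).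
  by rewrite -defG abelem_pgroup.
by rewrite -defG.
Qed.

Lemma maximal_over (gT : finGroupType) (Z M : {group gT}) :
  Z \proper M -> exists2 X : {group gT}, maximal Z X & X \subset M.
Proof.
move=> prZM.
have [X /mingroupP[prZX minX] sXM] :=
  @mingroup_exists _ (fun X => Z \proper X) M prZM.
exists X => //; apply/maxgroupP; split=> // K prKX sZK.
apply/eqP; rewrite eq_sym eqEproper sZK /=; apply/negP=> prZK.
by have:= prKX; rewrite (minX K prZK (proper_sub prKX)) properxx.
Qed.

(** A subgroup X properly containing Z lies in at most one maximal subgroup,
    X only in M and Y only in N. Hence no maximal subgroup contains both. *)
Lemma join_meet_over_const (gT : finGroupType) (G Z M N X Y : {group gT}) :
    (forall K L : {group gT},
       maximal K G -> maximal L G -> K != L -> K :&: L = Z) ->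
    maximal M G -> maximal N G -> M != N ->
    Z \proper X -> X \subset M -> Z \proper Y -> Y \subset N ->
  X <*> Y = G /\ X :&: Y = Z.
Proof.
move=> meetZ maxM maxN neqMN prX sXM prY sYN.
have sMG := proper_sub (maxgroupp maxM).
have sNG := proper_sub (maxgroupp maxN).
have uniq_max (K L W : {group gT}) : maximal K G -> maximal L G ->
    Z \proper W -> W \subset K -> W \subset L -> K = L.
  move=> maxK maxL /andP[_ nsWZ] sWK sWL; apply/eqP/negPn/negP=> neqKL.
  by case/negP: nsWZ; rewrite -(meetZ K L) // subsetI sWK.
split.
  have sXYG: X <*> Y \subset G.
    by rewrite join_subG (subset_trans sXM) ?(subset_trans sYN).
  case: (maximal_exists sXYG) => // -[K maxK].
  rewrite join_subG => /andP[sXK sYK]; case/eqP: neqMN.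
  rewrite -(uniq_max K M X) //; exact: uniq_max prY sYK sYN.
apply/eqP; rewrite eqEsubset subsetI (proper_sub prX) (proper_sub prY) andbT.
by rewrite -(meetZ M N) ?setISS.
Qed.

Lemma noncyclic_mem_maximal (gT : finGroupType) (G : {group gT}) (x : gT) :
  ~~ cyclic G -> x \in G -> exists2 M : {group gT}, maximal M G & x \in M.
Proof.
move=> ncG Gx.
have sxG: <[x]> \subset G by rewrite cycle_subG.
case: (maximal_exists sxG) => [defG | [M maxM]].
  by case/negP: ncG; rewrite -defG cycle_cyclic.
by rewrite cycle_subG; exists M.
Qed.

(** This is the argument that a group is not a union of two proper subgroups:
    for x in M but not in N and y in N but not in M, the product x * y is in
    neither. *)
Lemma three_maximals (gT : finGroupType) (G : {group gT}) :
    ~~ cyclic G ->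
  exists M N L : {group gT},
    [/\ maximal M G, maximal N G & maximal L G]
    /\ [/\ M != N, M != L & N != L].
Proof.
move=> ncG.
have [M maxM _] := noncyclic_mem_maximal ncG (group1 G).
have /properP[_ [y Gy notMy]] := maxgroupp maxM.
have [N maxN Ny] := noncyclic_mem_maximal ncG Gy.
have neqMN: M != N by apply: contraNneq notMy => ->.
have /subsetPn[x Mx notNx]: ~~ (M \subset N).
  by apply: contra neqMN => /(maximal_subset_eq maxN maxM)->.
have Gx := subsetP (proper_sub (maxgroupp maxM)) x Mx.
have [L maxL Lxy] := noncyclic_mem_maximal ncG (groupM Gx Gy).
exists M, N, L; split=> //; split=> //.
  by apply: contraNneq notMy => eqML; move: Lxy; rewrite -eqML groupMl.
by apply: contraNneq notNx => eqNL; move: Lxy; rewrite -eqNL groupMr.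
Qed.

Theorem theorem1p1 (gT : finGroupType) (G : {group gT}) (ncG : ~~ cyclic G) :
  exists (H : {group gT}) (x y z a : gT),
    [/\ H \subset G,
        [/\ x \in G, y \in G, z \in G & a \in G],
        diamond H <[x]>%G <[y]>%G <[z]>%G <[a]>%G,
        maximal <[a]> <[x]>
      & maximal <[a]> <[y]>].
Proof.
have [H /mingroupP[ncH minH] sHG] :=
  @mingroup_exists _ (fun K => ~~ cyclic K) G ncG.
have cycH (K : {group gT}) : K \proper H -> cyclic K.
  move=> prK; apply: contraT => ncK.
  by have:= prK; rewrite (minH K ncK (proper_sub prK)) properxx.
have [Z meetZ] := maximal_meet_const ncH cycH.
have [M [N [L [[maxM maxN maxL] [neqMN neqML neqNL]]]]] := three_maximals ncH.
(* Z = K would put K inside every other maximal subgroup. *)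
have prZ (K K' : {group gT}) :
    maximal K H -> maximal K' H -> K != K' -> Z \proper K.
  move=> maxK maxK' neqK; rewrite -(meetZ K K') // properE subsetIl subsetI.
  rewrite subxx /=.
  by apply: contra neqK => /(maximal_subset_eq maxK' maxK)->.
have over (K K' : {group gT}) : maximal K H -> maximal K' H -> K != K' ->
    exists x, maximal Z <[x]> /\ <[x]> \subset K.
  move=> maxK maxK' neqK.
  have [X maxZX sXK] := maximal_over (prZ K K' maxK maxK' neqK).
  have /cyclicP[x defX] := cyclicS sXK (cycH _ (maxgroupp maxK)).
  by exists x; rewrite -defX.
have [x [maxZx sxM]] := over M N maxM maxN neqMN.
have [y [maxZy syN]] : exists y, maximal Z <[y]> /\ <[y]> \subset N.
  by apply: (over N M); rewrite // eq_sym.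
have [z [maxZz szL]] : exists z, maximal Z <[z]> /\ <[z]> \subset L.
  by apply: (over L M); rewrite // eq_sym.
have [Jxy Ixy] := join_meet_over_const meetZ maxM maxN neqMN
  (maxgroupp maxZx) sxM (maxgroupp maxZy) syN.
have [Jxz Ixz] := join_meet_over_const meetZ maxM maxL neqML
  (maxgroupp maxZx) sxM (maxgroupp maxZz) szL.
have [Jyz Iyz] := join_meet_over_const meetZ maxN maxL neqNL
  (maxgroupp maxZy) syN (maxgroupp maxZz) szL.
have /cyclicP[a defZ] := cyclicS (proper_sub (maxgroupp maxZx)) (cycle_cyclic x).
have inG (K : {group gT}) w : maximal K H -> <[w]> \subset K -> w \in G.
  move=> maxK; rewrite -cycle_subG => swK; apply: subset_trans swK _.
  exact: subset_trans (proper_sub (maxgroupp maxK)) sHG.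
have [Gx Gy Gz] : [/\ x \in G, y \in G & z \in G].
  by split; [apply: (inG M) | apply: (inG N) | apply: (inG L)].
have Ga : a \in G.
  rewrite -cycle_subG -defZ (subset_trans (proper_sub (maxgroupp maxZx))) //.
  by rewrite cycle_subG.
have neqH w : (H == <[w]>%G) = false.
  by apply: contraNF ncH => /eqP->; apply: cycle_cyclic.
have neq_join u v : <[u]> <*> <[v]> = H -> (<[u]>%G == <[v]>%G) = false.
  move=> Juv; apply: contraNF ncH => /eqP[equv].
  by rewrite -Juv equv joingE setUid genGid cycle_cyclic.
have neq_a w : maximal Z <[w]> -> (<[w]>%G == <[a]>%G) = false.
  move=> maxZw; apply: contraTF (maxgroupp maxZw) => /eqP[->].
  by rewrite defZ properxx.
exists H, x, y, z, a; split=> //; rewrite -?defZ //.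
split; rewrite /= -?defZ //.
by rewrite !inE !neqH !neq_a // !neq_join.
Qed.
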